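(* Let $k$ and $r$ be integers with $1 \leq r \leq k-2$. Then (a) if $2k+r = 2^t$ for some integer $t$, then $\chi(K^2(2k+r,k)) \leq (2k+r)^r$; (b) if $2k+r = 2^t - 1$ for some integer $t$, then $\chi(K^2(2k+r,k)) \leq (2k+r+1)^r$.
   Context: For integers $n \geq 2k \ge 2$, the Kneser graph $K(n,k)$ has as vertices the $k$-element subsets of an $n$-element set, two vertices being adjacent iff they are disjoint. For a graph $G$, the square $G^2$ has vertex set $V(G)$, with two distinct vertices adjacent iff their distance in $G$ is at most 2. $K^2(n,k)$ denotes the square of $K(n,k)$, and $\chi$ denotes the chromatic number. *)

(* Defs.v *)
From mathcomp Require Import all_boot.
Set Implicit Arguments.
Unset Strict Implicit.
Unset Printing Implicit Defensive.

Record sgraph := SGraph {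
  vertex :> finType;
  adj : rel vertex;
  adj_sym : symmetric adj;
  adj_irrefl : irreflexive adj
}.

Definition proper_coloring (G : sgraph) (c : nat) (f : {ffun G -> 'I_c}) : bool :=
  [forall x, forall y, adj x y ==> (f x != f y)].

Definition colorable (G : sgraph) (c : nat) : bool :=
  [exists f : {ffun G -> 'I_c}, proper_coloring f].

Lemma colorable_exists (G : sgraph) : exists c, colorable G c.
Proof.
exists #|G|; apply/existsP; exists [ffun x => enum_rank x].
apply/forallP => x; apply/forallP => y; apply/implyP => xy.
rewrite !ffunE (inj_eq enum_rank_inj); apply: contraTneq xy => ->.
by rewrite adj_irrefl.
Qed.

Definition chromatic_number (G : sgraph) : nat := ex_minn (colorable_exists G).

(* The distance from x to y in G is at most d: a walk with i <= d edges starts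
   at x and ends at y. *)
Definition dist_le (G : sgraph) (d : nat) (x y : G) : bool :=
  [exists i : 'I_d.+1, exists p : i.-tuple G,
     path (@adj G) x p && (last x p == y)].

Lemma dist_le_imp_sym (G : sgraph) (d : nat) (x y : G) :
  dist_le d x y -> dist_le d y x.
Proof.
case/existsP => i /existsP [p /andP [xp /eqP <-]].
have sz : size (rev (belast x p)) == i by rewrite size_rev size_belast size_tuple.
apply/existsP; exists i; apply/existsP; exists (Tuple sz) => /=.
rewrite rev_path (eq_path (e' := @adj G)) ?xp => [|u v]; last exact: adj_sym.
by case: (tval p) => //= z s; rewrite rev_cons last_rcons eqxx.
Qed.

Definition square_adj (G : sgraph) : rel G := fun x y => (x != y) && dist_le 2 x y.

Lemma square_adj_sym (G : sgraph) : symmetric (@square_adj G).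
Proof.
move=> x y; rewrite /square_adj /= eq_sym; congr (_ && _).
by apply/idP/idP; apply: dist_le_imp_sym.
Qed.

Lemma square_adj_irrefl (G : sgraph) : irreflexive (@square_adj G).
Proof. by move=> x; rewrite /square_adj /= eqxx. Qed.

Definition graph_square (G : sgraph) : sgraph :=
  SGraph (@square_adj_sym G) (@square_adj_irrefl G).

(* For k > 0 disjointness already implies A != B; the latter only prevents a
   loop at the empty set when k = 0. *)
Definition kneser_adj (n k : nat) : rel {A : {set 'I_n} | #|A| == k} :=
  fun A B => (A != B) && [disjoint val A & val B].

Lemma kneser_adj_sym (n k : nat) : symmetric (@kneser_adj n k).
Proof. by move=> A B; rewrite /kneser_adj /= eq_sym disjoint_sym. Qed.

Lemma kneser_adj_irrefl (n k : nat) : irreflexive (@kneser_adj n k).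
Proof. by move=> A; rewrite /kneser_adj /= eqxx. Qed.

Definition kneser (n k : nat) : sgraph :=
  SGraph (@kneser_adj_sym n k) (@kneser_adj_irrefl n k).

(* Main.v *)
Require Import Defs.
From mathcomp Require Import all_boot.
From mathcomp Require Import all_algebra all_fingroup all_solvable all_field zify.

(** Identify the ground set with all elements (case (a)), or all but one element
    (case (b)), of the field F with q = 2^t elements, and write
    f_A = \prod_(a in A) (X - a).  Colour the k-subset A with the r coefficients
    of f_A in degrees k - r, ..., k - 1.  Suppose A and B are adjacent in the square
    and have the same colour, so that deg (f_A - f_B) < k - r.
    - If A and B have a common neighbour, then |A :&: B| >= k - r, and
      f_{A :&: B} divides f_A - f_B; hence f_A = f_B and A = B.
    - If A and B are disjoint, let h be the product of the X - c over the at most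
      r + 1 elements c of F outside A :|: B.  Then f_A f_B h = X^q - X.  With
      g = f_B - f_A, differentiating in characteristic 2 gives
      f_A^2 h' + (f_A g h)' = -1, where deg (f_A g h)' < 2k, so h' = 0.
      Evaluating (f_A f_B h)' = -1 at a root of h is then absurd. *)

Set Implicit Arguments.
Unset Strict Implicit.
Unset Printing Implicit Defensive.

Import GRing.Theory.
Local Open Scope ring_scope.

Section SetPolynomial.
Variable F : finFieldType.
Implicit Types A B C : {set F}.

Definition set_poly A : {poly F} := \prod_(a in A) ('X - a%:P).

Lemma size_set_poly A : size (set_poly A) = #|A|.+1.
Proof. by rewrite /set_poly -big_enum size_prod_XsubC -cardE. Qed.

Lemma set_poly_neq0 A : set_poly A != 0.
Proof. by rewrite -size_poly_gt0 size_set_poly. Qed.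

Lemma root_set_poly A x : root (set_poly A) x = (x \in A).
Proof. by rewrite /set_poly -big_enum root_prod_XsubC mem_enum. Qed.

Lemma set_poly_inj : injective set_poly.
Proof. by move=> A B eqAB; apply/setP => x; rewrite -!root_set_poly eqAB. Qed.

Lemma set_polyU A B :
  [disjoint A & B] -> set_poly (A :|: B) = set_poly A * set_poly B.
Proof. by move=> dAB; rewrite /set_poly -bigU //=; apply: eq_bigl => x; rewrite inE. Qed.

Lemma set_polyT : set_poly [set: F] = 'X^#|F| - 'X.
Proof. by rewrite finField_genPoly; apply: eq_bigl => x; rewrite inE. Qed.

Lemma deriv_set_polyT : (set_poly [set: F])^`() = -1.
Proof.
rewrite set_polyT derivB derivX derivXn -mulr_natr -polyC_natr.
(* By Lagrange in the additive group of [F], adding 1 to itself [#|F|] times gives 0. *)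
have -> : #|F|%:R = 0 :> F by rewrite -FinRing.zmodXgE -cardsT expg_cardG ?inE.
by rewrite mulr0 sub0r.
Qed.

(** Both polynomials are monic of degree [k], so degree [k] cancels as well as the [r] degrees just
    below it. *)
Lemma size_set_polyB_le k r A B : #|A| = k -> #|B| = k -> (r <= k)%N ->
    (forall i : 'I_r, (set_poly A)`_(k - r + i) = (set_poly B)`_(k - r + i)) ->
  (size (set_poly A - set_poly B)%R <= k - r)%N.
Proof.
move=> cA cB le_rk eqAB; apply/leq_sizeP => j le_j.
have monic_coef C : #|C| = k -> (set_poly C)`_k = 1.
  move=> cC; have -> : k = (size (set_poly C)).-1 by rewrite size_set_poly cC.
  exact/monicP/monic_prod_XsubC.
rewrite coefB; have [lt_jk | lt_kj | ->] := ltngtP j k.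
- have lt_jr : (j - (k - r) < r)%N by lia.
  by have := eqAB (Ordinal lt_jr); rewrite /= subnKC // => ->; rewrite subrr.
- by rewrite !nth_default ?size_set_poly ?cA ?cB ?subrr.
- by rewrite !monic_coef ?subrr.
Qed.

(** The factor [set_poly (A :&: B)] splits off the difference, and a nonzero multiple of it has size
    at least [#|A :&: B|.+1]. *)
Lemma eq_set_of_size_set_polyB A B :
  (size (set_poly A - set_poly B)%R <= #|A :&: B|)%N -> A = B.
Proof.
have splitE C D : set_poly C = set_poly (C :&: D) * set_poly (C :\: D).
  rewrite -set_polyU ?setID // -setI_eq0.
  by apply/eqP/setP => x; rewrite !inE; do !case: (x \in _).
rewrite (splitE A B) (splitE B A) (setIC B A) -mulrBr => le_sz.
apply: set_poly_inj; rewrite (splitE A B) (splitE B A) (setIC B A).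
apply/eqP; rewrite -subr_eq0 -mulrBr; apply: contraTT le_sz.
rewrite mulf_eq0 negb_or -ltnNge => /andP [nz1 nz2].
rewrite size_mul // size_set_poly; move: nz2; rewrite -size_poly_gt0; lia.
Qed.

Lemma size_set_polyB_gt_of_disjoint k r A B : 2 \in [pchar F] ->
    #|A| = k -> #|B| = k -> (0 < k)%N -> (r <= k)%N -> [disjoint A & B] ->
    (2 * k < #|F| <= 2 * k + r.+1)%N ->
  (k - r < size (set_poly A - set_poly B)%R)%N.
Proof.
move=> pch2 cA cB k_gt0 le_rk dAB /andP [ltF leF]; rewrite ltnNge; apply/negP => le_g.
set C := ~: (A :|: B); set h := set_poly C.
have cC : #|C| = (#|F| - 2 * k)%N.
  by rewrite cardsCs setCK cardsU disjoint_setI0 // cards0 cA cB subn0 addnn mul2n.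
have prodT : set_poly A * set_poly B * h = set_poly [set: F].
  by rewrite -set_polyU // -set_polyU ?setUCr // -setI_eq0 setICr.
have dprod : (set_poly A * set_poly B * h)^`() = -1 by rewrite prodT deriv_set_polyT.
have nz_dh : h^`() != 0.
  (* The strict bound [2 * k < #|F|] supplies a root [c] of [h]. *)
  have /card_gt0P [c cCc] : (0 < #|C|)%N by lia.
  apply: contra_eq_neq dprod => dh0; rewrite derivM dh0 mulr0 addr0.
  apply/eqP => /(congr1 (horner^~ c)) /eqP; rewrite hornerM.
  have /rootP -> : root h c by rewrite root_set_poly.
  by rewrite mulr0 hornerN hornerC eq_sym oppr_eq0 oner_eq0.
set g := set_poly B - set_poly A.
have szg : (size g <= k - r)%N by rewrite -size_polyN opprB.
have fBE : set_poly B = set_poly A + g by rewrite addrC subrK.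
have eq_dh : set_poly A ^+ 2 * h^`() = -1 - (set_poly A * g * h)^`().
  rewrite -dprod fBE mulrDr mulrDl derivD addrK -expr2 derivM deriv_exp.
  by rewrite -mulr_natr -polyC_natr (pcharf0 pch2) mulr0 mul0r add0r.
(* The factors have sizes [k + 1], at most [k - r], and at most [r + 2], so a nonzero product has
   size at most [2 * k + 1]; differentiating lowers this by one. *)
have szgh : (size (set_poly A * g * h)^`()%R <= 2 * k)%N.
  have [-> | nz] := eqVneq (set_poly A * g * h) 0; first by rewrite deriv0 size_poly0.
  have := lt_size_deriv nz; have := size_polyMleq (set_poly A * g) h.
  have := size_polyMleq (set_poly A) g; rewrite /h !size_set_poly cA cC; lia.
have : (size (set_poly A ^+ 2 * h^`())%R <= 2 * k)%N.
  rewrite eq_dh; apply: leq_trans (size_polyD _ _) _.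
  by rewrite !size_polyN size_poly1 geq_max szgh andbT; lia.
(* Since the derivative of [h] is nonzero, the left side has size at least [2 * k + 1]. *)
rewrite expr2 !size_mul ?mulf_neq0 ?set_poly_neq0 // size_set_poly cA.
by move: nz_dh; rewrite -size_poly_gt0; case: (size h^`()) => // s _; lia.
Qed.

End SetPolynomial.

Local Open Scope nat_scope.

Lemma chromatic_number_le_card (G : sgraph) (T : finType) (f : G -> T) :
  (forall x y : G, adj x y -> f x != f y) -> chromatic_number G <= #|T|.
Proof.
move=> f_proper; rewrite /chromatic_number; case: ex_minnP => m _; apply.
apply/existsP; exists [ffun x => enum_rank (f x)].
apply/forallP => x; apply/forallP => y; apply/implyP => /f_proper.
by rewrite !ffunE (inj_eq enum_rank_inj).
Qed.

(** A common neighbour is a [k]-set outside the union of [A] and [B], which has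
    [2 * k - #|val A :&: val B|] elements. *)
Lemma kneser_square_adj_cases (n k : nat) (A B : kneser n k) :
    square_adj A B ->
  [disjoint val A & val B] \/ 3 * k <= n + #|val A :&: val B|.
Proof.
case/andP => neqAB /existsP [[m lt_m] /existsP [p /andP [Ap /eqP Bp]]].
have := size_tuple p; move: Ap Bp; rewrite /=.
case: (tval p) => [|C [|D [|? ?]]] /=.
- by move=> _ eqAB; rewrite eqAB eqxx in neqAB.
- by move=> /andP [/andP [_ dAC] _] <-; left.
- move=> /and3P [/andP [_ dAC] /andP [_ dCB] _] eqDB _; right.
  rewrite eqDB in dCB.
  have dC : [disjoint val A :|: val B & val C].
    by rewrite -setI_eq0 setIUl setU_eq0 !setI_eq0 dAC disjoint_sym.
  have := max_card (((val A :|: val B) :|: val C)).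
  rewrite card_ord cardsU (disjoint_setI0 dC) cards0 cardsU.
  have := subset_leq_card (subsetIl (val A) (val B)).
  rewrite (eqP (valP A)) (eqP (valP B)) (eqP (valP C)); move: #|_ :&: _| => i; lia.
- by move=> _ _ sz; have := lt_m; rewrite -sz.
Qed.

Lemma chromatic_kneser_square_le (F : finFieldType) (k r : nat) :
    2 \in [pchar F]%R -> 0 < r <= k -> 2 * k + r <= #|F| <= 2 * k + r.+1 ->
  chromatic_number (graph_square (kneser (2 * k + r) k)) <= #|F| ^ r.
Proof.
move=> pch2 /andP [r_gt0 le_rk] /andP [geF leF].
pose e (i : 'I_(2 * k + r)) : F := enum_val (widen_ord geF i).
have e_inj : injective e.
  by move=> i j /enum_val_inj /(congr1 val) /= /val_inj.
pose im (A : kneser (2 * k + r) k) : {set F} := e @: val A.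
have card_im A : #|im A| = k by rewrite card_imset // (eqP (valP A)).
pose color A := [ffun i : 'I_r => ((set_poly (im A))`_(k - r + i))%R].
have -> : #|F| ^ r = #|{ffun 'I_r -> F}| by rewrite card_ffun card_ord.
pose K2 := graph_square (kneser (2 * k + r) k).
apply: (@chromatic_number_le_card K2 _ color) => A B adjAB; apply/eqP => eq_col.
have szAB : size (set_poly (im A) - set_poly (im B))%R <= k - r.
  apply: size_set_polyB_le => // i.
  by have /ffunP/(_ i) := eq_col; rewrite !ffunE.
have [dAB | leI] := kneser_square_adj_cases adjAB.
  have: k - r < size (set_poly (im A) - set_poly (im B))%R.
    apply: size_set_polyB_gt_of_disjoint => //; try lia.
    by rewrite -setI_eq0 -imsetI ?disjoint_setI0 ?imset0 // => x y _ _ /e_inj.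
  by rewrite ltnNge szAB.
(* For [n = 2 * k + r], the bound [leI] says that the intersection has at least [k - r] elements. *)
case/andP: adjAB => /eqP neqAB _; apply/neqAB/val_inj/(imset_inj e_inj).
apply: eq_set_of_size_set_polyB; apply: leq_trans szAB _.
rewrite -imsetI; last by move=> x y _ _ /e_inj.
by move: leI; rewrite card_imset //; move: #|_ :&: _| => i; lia.
Qed.

Theorem theorem2 (k r : nat) (hr : 1 <= r <= k - 2) :
  ((exists t : nat, 2 * k + r = 2 ^ t) ->
     chromatic_number (graph_square (kneser (2 * k + r) k)) <= (2 * k + r) ^ r)
  /\
  ((exists t : nat, 2 * k + r = 2 ^ t - 1) ->
     chromatic_number (graph_square (kneser (2 * k + r) k)) <= (2 * k + r + 1) ^ r).
Proof.
split=> -[t nE].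
  (* The exponent 0 is excluded because [hr] forces [k >= 3]. *)
  have t_gt0 : 0 < t by case: t nE => //; lia.
  have [F pch2 cF] := pPrimePowerField (isT : prime 2) t_gt0.
  rewrite {2}nE -cF; apply: chromatic_kneser_square_le => //; [lia | rewrite cF; lia].
have t_gt0 : 0 < t by case: t nE => //; lia.
have [F pch2 cF] := pPrimePowerField (isT : prime 2) t_gt0.
have nE1 : 2 * k + r + 1 = #|F| by rewrite cF; lia.
by rewrite nE1; apply: chromatic_kneser_square_le => //; lia.
Qed.
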